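(* Let $\ell\ge2$ and $i,j\in\{1,\dots,\ell\}$. The adjoint action of the elements $S^D_i\in O_{2\ell}$ on $\mathfrak{so}_{2\ell}$ satisfies $$\mathrm{Ad}_{S^D_i}(e_j)=\begin{cases} f_j,& i=j\\ -e_j,& a_{ij}=0,\ \iota(i)=j\\ e_j,& a_{ij}=0,\ \iota(i)\ne j\\ -\mathrm{ad}_{e_i}(e_j),& a_{ij}=-1,\ i<j\\ \mathrm{ad}_{e_i}(e_j),& a_{ij}=-1,\ i>j\end{cases} \qquad\text{and}\qquad \mathrm{Ad}_{S^D_i}(f_j)=\begin{cases} e_j,& i=j\\ -f_j,& a_{ij}=0,\ \iota(i)=j\\ f_j,& a_{ij}=0,\ \iota(i)\ne j\\ \mathrm{ad}_{f_i}(f_j),& a_{ij}=-1,\ i<j\\ -\mathrm{ad}_{f_i}(f_j),& a_{ij}=-1,\ i>j.\end{cases}$$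
   Context: $\mathrm{Ad}_g(X)=gXg^{-1}$, $\mathrm{ad}_X(Y)=[X,Y]$, $e_{ab}$ are the standard $2\ell\times2\ell$ matrix units. $\iota$ is the symmetry of the Dynkin diagram $D_\ell$ exchanging the vertices $1$ and $2$ and fixing all the others. $\mathfrak{so}_{2\ell}=\{X\in\mathfrak{gl}_{2\ell}(\mathbb C): X=-\mathcal S X^\tau\mathcal S^{-1}\}$ and $O_{2\ell}=\{g\in GL_{2\ell}(\mathbb C): g=\mathcal S(g^\tau)^{-1}\mathcal S^{-1}\}$, where $(X^\tau)_{ij}=X_{2\ell+1-j,\,2\ell+1-i}$ and $\mathcal S=\mathrm{diag}(1,-1,\ldots,(-1)^{\ell-1};(-1)^{\ell-1},(-1)^{\ell},\ldots,1)$ has palindromic diagonal. Chevalley generators: $e_1=e_{\ell-1,\ell+1}+e_{\ell,\ell+2}$, $f_1=e_{\ell+1,\ell-1}+e_{\ell+2,\ell}$, and for $1<k\le\ell$: $e_k=e_{\ell+1-k,\ell+2-k}+e_{\ell+k-1,\ell+k}$, $f_k=e_{\ell+2-k,\ell+1-k}+e_{\ell+k,\ell+k-1}$. Cartan matrix: $a_{ii}=2$; $a_{12}=a_{21}=0$; $a_{13}=a_{31}=-1$; $a_{k,k+1}=a_{k+1,k}=-1$ for $k\ge2$; all other entries $0$. With $T_i$ the diagonal matrix having $-1$ at place $i$ and $1$ elsewhere, $S_i$ the permutation matrix of $(i\;i+1)$ and $\overline S_i=T_iS_iT_i^{-1}$: $S_1^D=S_\ell S_{\ell-1}\overline S_{\ell+1}S_\ell$,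 $S^D_k=S_{\ell+1-k}\overline S_{\ell-1+k}$ for $1<k\le\ell$. *)

(* Defs.v *)
From HB Require Import structures.
From mathcomp Require Import all_boot all_order all_algebra perm.
From mathcomp Require Import reals complex.

Set Implicit Arguments.
Unset Strict Implicit.
Unset Printing Implicit Defensive.

Import GRing.Theory.
Local Open Scope ring_scope.

(* Rows, columns and Dynkin vertices are numbered from 1 by natural numbers, so
   the ordinal r stands for place r.+1.  All indices and differences of indices
   occurring below are in range when 2 <= l and 1 <= k <= l. *)

Section Orthogonal.
Variables (F : fieldType) (l : nat).
Implicit Types (X Y g : 'M[F]_(2 * l)) (a b i k : nat).

Definition mxunit a b : 'M[F]_(2 * l) :=
  \matrix_(r, c) ((r.+1 == a) && (c.+1 == b))%:R.

Definition antitr X : 'M[F]_(2 * l) :=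
  \matrix_(r, c) X (rev_ord c) (rev_ord r).

Definition signmx : 'M[F]_(2 * l) :=
  diag_mx (\row_r (if (r < l)%N then (-1) ^+ r else (-1) ^+ rev_ord r)).

Definition so : {pred 'M[F]_(2 * l)} :=
  [pred X | X == - (signmx *m antitr X *m invmx signmx)].

(* invmx is the inverse only on unitmx, whence the first conjunct *)
Definition Ogrp : {pred 'M[F]_(2 * l)} :=
  [pred g | (g \in unitmx) &&
            (g == signmx *m invmx (antitr g) *m invmx signmx)].

Definition Ad g X := g *m X *m invmx g.
Definition ad X Y := X *m Y - Y *m X.

Definition chev_e k : 'M[F]_(2 * l) :=
  if k == 1%N then mxunit (l - 1) (l + 1) + mxunit l (l + 2)
  else mxunit (l + 1 - k) (l + 2 - k) + mxunit (l + k - 1) (l + k).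

Definition chev_f k : 'M[F]_(2 * l) :=
  if k == 1%N then mxunit (l + 1) (l - 1) + mxunit (l + 2) l
  else mxunit (l + 2 - k) (l + 1 - k) + mxunit (l + k) (l + k - 1).

Definition Tmx i : 'M[F]_(2 * l) :=
  diag_mx (\row_r (if r.+1 == i then -1 else 1)).

(* the permutation matrix of the transposition (i i+1); see SmxE *)
Definition Smx i : 'M[F]_(2 * l) :=
  \matrix_(r, c) ([eta id with i |-> i.+1, i.+1 |-> i] r.+1 == c.+1)%:R.

Definition Sbar i := Tmx i *m Smx i *m invmx (Tmx i).

Definition SD k : 'M[F]_(2 * l) :=
  if k == 1%N then Smx l *m Smx (l - 1) *m Sbar (l + 1) *m Smx l
  else Smx (l + 1 - k) *m Sbar (l - 1 + k).

Lemma mxunitE (a b : 'I_(2 * l)) : mxunit a.+1 b.+1 = delta_mx a b.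
Proof. by apply/matrixP=> r c; rewrite !mxE. Qed.

Lemma SmxE (a b : 'I_(2 * l)) :
  b = a.+1 :> nat -> Smx a.+1 = perm_mx (tperm a b).
Proof.
move=> ab; apply/matrixP=> r c; rewrite !mxE /=.
case: tpermP => [->|->|/eqP ra /eqP rb].
- by rewrite eqxx -ab eqSS val_eqE.
- by rewrite ab eqxx (gtn_eqF (ltnSn _)) eqSS val_eqE.
- by rewrite !eqSS -ab !val_eqE (negPf ra) (negPf rb) eqSS val_eqE.
Qed.

End Orthogonal.

Arguments so F l : clear implicits.
Arguments Ogrp F l : clear implicits.

Definition cartanD (i j : nat) : int :=
  if i == j then 2
  else if [&& i == 1%N & j == 3%N] || [&& i == 3%N & j == 1%N] then -1
  else if [&& (2 <= i)%N & j == i.+1] || [&& (2 <= j)%N & i == j.+1] then -1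
  else 0.

Definition diagram_swap (i : nat) : nat :=
  if i == 1%N then 2%N else if i == 2%N then 1%N else i.

(* Main.v *)
Require Import Defs.
From HB Require Import structures.
From mathcomp Require Import all_boot all_order all_algebra perm.
From mathcomp Require Import zify.
From mathcomp Require Import reals complex.

Set Implicit Arguments.
Unset Strict Implicit.
Unset Printing Implicit Defensive.

Import GRing.Theory.
Local Open Scope ring_scope.

(* Set [lo 1 = l-1], [hi 1 = l+1], [lo k = l+1-k], [hi k = l+2-k] for [k > 1],
   and [bar x = 2l+1-x].  Then uniformly in [k], [e_k] is the sum of the matrix
   units at [(lo k, hi k)] and [(bar (hi k), bar (lo k))], [f_k] is its
   transpose, and [S^D_k] is the involutive signed permutation matrix that
   exchanges [lo k] with [hi k] and [bar (hi k)] with [bar (lo k)], the latter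
   two with a minus sign.  Conjugation by a signed permutation matrix permutes
   the matrix units up to sign, so every case becomes a comparison of indices
   and signs.  Since [S^D_k] is symmetric, transposing the formulas for the
   [e_j] gives those for the [f_j], the bracket changing sign. *)

Lemma invmx_right (F : fieldType) n (A B : 'M[F]_n) :
  A *m B = 1%:M -> invmx A = B.
Proof.
move=> AB; have [uA _] := mulmx1_unit AB.
by rewrite -[LHS]mulmx1 -AB mulmxA mulVmx // mul1mx.
Qed.

(** * Products of signed permutation matrices and matrix units *)

Section SignedPermutations.
Variables (F : fieldType) (l : nat).
Implicit Types (p q : nat -> nat) (s t : nat -> bool).

Definition inrange x := (1 <= x <= 2 * l)%N.

(* [monomial p s] sends the [x]-th basis vector to the [p x]-th one, with a
   minus sign when [s x] holds. *)
Definition monomial p s : 'M[F]_(2 * l) :=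
  \matrix_(r, c) ((-1) ^+ s c.+1 *+ (r.+1 == p c.+1)).

Lemma ord_inrange (k : 'I_(2 * l)) : inrange k.+1.
Proof. exact: ltn_ord k. Qed.
#[local] Hint Resolve ord_inrange : core.

Lemma inrange_ord x : inrange x -> exists k : 'I_(2 * l), x = k.+1.
Proof. by case: x => // x xl; exists (Ordinal (xl : (x < 2 * l)%N)). Qed.

Lemma eq_monomial p q s t :
    (forall x, inrange x -> p x = q x) -> (forall x, inrange x -> s x = t x) ->
  monomial p s = monomial q t.
Proof. by move=> pq st; apply/matrixP => r c; rewrite !mxE pq ?st. Qed.

Lemma monomial1 p s : (forall x, inrange x -> p x = x) ->
  (forall x, inrange x -> s x = false) -> monomial p s = 1%:M.
Proof.
by move=> p1 s1; apply/matrixP => r c; rewrite !mxE p1 ?s1.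
Qed.

Lemma mul_monomial p q s t : (forall x, inrange x -> inrange (q x)) ->
  monomial p s *m monomial q t =
  monomial (fun x => p (q x)) (fun x => s (q x) (+) t x).
Proof.
move=> qr; apply/matrixP => r c; rewrite !mxE.
(* As [q c.+1] is in range, it is a genuine index, and the sum collapses to that term. *)
have [k qk] := inrange_ord (qr c.+1 (ord_inrange c)).
rewrite (bigD1 k) //= big1 => [|k' kk']; rewrite !mxE qk.
  by rewrite eqxx mulr1n signr_addb mulrnAl addr0.
by rewrite eqSS val_eqE (negPf kk') mulr0.
Qed.

Lemma mul_monomial_mxunit p s a b : inrange a ->
  monomial p s *m mxunit F l a b = (-1) ^+ s a *: mxunit F l (p a) b.
Proof.
case/inrange_ord => k ->; apply/matrixP => r c; rewrite !mxE.
rewrite (bigD1 k) //= big1 => [|k' kk']; rewrite !mxE.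
  by rewrite eqxx addr0; case: (r.+1 == _); rewrite ?mulr0n ?mul0r ?mulr0.
by rewrite eqSS val_eqE (negPf kk') mulr0.
Qed.

(** Row [b] of [monomial p s] is nonzero at the preimage of [b], which is [p b] as [p] is an
    involution. *)
Lemma mul_mxunit_monomial p s a b : (forall x, p (p x) = x) -> inrange b ->
  mxunit F l a b *m monomial p s = (-1) ^+ s (p b) *: mxunit F l a (p b).
Proof.
move=> pp /inrange_ord[k ->]; apply/matrixP => r c; rewrite !mxE.
rewrite (bigD1 k) //= big1 => [|k' kk']; rewrite !mxE.
  have -> : (k.+1 == p c.+1) = (c.+1 == p k.+1).
    by apply/eqP/eqP => ->; rewrite pp.
  rewrite eqxx andbT addr0; case: (c.+1 =P _) => [->|_].
    by rewrite andbT mulr1n mulrC.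
  by rewrite andbF mulr0n !mulr0.
by rewrite eqSS val_eqE (negPf kk') andbF mul0r.
Qed.

Lemma mul_mxunit a b c d : inrange b ->
  mxunit F l a b *m mxunit F l c d = mxunit F l a d *+ (b == c).
Proof.
case/inrange_ord => k ->; apply/matrixP => r x; rewrite mulmxnE !mxE.
rewrite (bigD1 k) //= big1 => [|k' kk']; rewrite !mxE.
  by rewrite eqxx andbT addr0; case: (r.+1 == a); case: (k.+1 == c);
    rewrite ?mul0r ?mul1r ?mulr0n ?mul0rn.
by rewrite eqSS val_eqE (negPf kk') andbF mul0r.
Qed.

(** * Anti-transposition, the sign matrix, and stability of [so] under the group *)

Definition bar x := ((2 * l).+1 - x)%N.

Lemma bar_ord (r : 'I_(2 * l)) : (rev_ord r).+1 = bar r.+1.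
Proof. by rewrite /bar /=; have := ltn_ord r; lia. Qed.

Lemma bar_inrange x : inrange x -> inrange (bar x).
Proof. rewrite /inrange /bar; lia. Qed.

Lemma barK x : inrange x -> bar (bar x) = x.
Proof. rewrite /inrange /bar; lia. Qed.

Lemma antitr_monomial p s : (forall x, p (p x) = x) ->
    (forall x, inrange x -> inrange (p x)) ->
  antitr (monomial p s) =
  monomial (fun x => bar (p (bar x))) (fun x => s (p (bar x))).
Proof.
move=> pp pr; apply/matrixP => r c; rewrite !mxE !bar_ord.
have pl : inrange (p (bar c.+1)) by exact/pr/bar_inrange.
have -> : (bar c.+1 == p (bar r.+1)) = (r.+1 == bar (p (bar c.+1))).
  by apply/eqP/eqP => [->|->]; rewrite ?pp barK ?pp.
by case: eqP => [->|_]; rewrite ?mulr0n ?barK.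
Qed.

Lemma antitr_mxunit a b : inrange a -> inrange b ->
  antitr (mxunit F l a b) = mxunit F l (bar b) (bar a).
Proof.
move=> ar br; apply/matrixP => r c; rewrite !mxE !bar_ord andbC.
by congr (_ && _)%:R; rewrite /bar; move: ar br (ltn_ord r) (ltn_ord c);
  rewrite /inrange; lia.
Qed.

Lemma antitrM (X Y : 'M[F]_(2 * l)) : antitr (X *m Y) = antitr Y *m antitr X.
Proof.
apply/matrixP => r c; rewrite !mxE (reindex_inj rev_ord_inj) /=.
by apply: eq_bigr => k _; rewrite !mxE mulrC.
Qed.

Lemma antitr1 : antitr 1%:M = 1%:M :> 'M[F]_(2 * l).
Proof.
by apply/matrixP => r c; rewrite !mxE (inj_eq rev_ord_inj) eq_sym.
Qed.

Lemma antitrD (X Y : 'M[F]_(2 * l)) : antitr (X + Y) = antitr X + antitr Y.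
Proof. by apply/matrixP => r c; rewrite !mxE. Qed.

Lemma antitr_inv (g : 'M[F]_(2 * l)) :
  g \in unitmx -> antitr (invmx g) = invmx (antitr g).
Proof.
move=> ug; apply/esym/invmx_right.
by rewrite -antitrM mulVmx // antitr1.
Qed.

(** True where the diagonal of [signmx] is -1; [x] counts from 1, so [rev_ord] becomes
    [2 * l - x]. *)
Definition altsign x := odd (if (x <= l)%N then x.-1 else (2 * l - x)%N).

Lemma signmxE : signmx F l = monomial id altsign.
Proof.
apply/matrixP => r c; rewrite !mxE eqSS val_eqE.
case: (r =P c) => [->|]; rewrite ?mulr0n // /altsign /=.
by case: ltnP => _; rewrite signr_odd.
Qed.

Lemma signmxV : invmx (signmx F l) = signmx F l.
Proof.
apply: invmx_right; rewrite signmxE mul_monomial //.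
by apply: monomial1 => // x _; rewrite addbb.
Qed.

Lemma signmx_unit : signmx F l \in unitmx.
Proof.
apply: (proj1 (@mulmx1_unit _ _ _ (signmx F l) _)).
by rewrite signmxE mul_monomial // monomial1 // => x _; rewrite addbb.
Qed.

(** The group condition moves [signmx] past [g] ([gS]) and, inverted, past [antitr g] ([Sg]). The
    twisted anti-transpose of [Ad g X] thus becomes [Ad g] of that of [X]. *)
Lemma Ad_so (g X : 'M[F]_(2 * l)) :
  g \in Ogrp F l -> X \in so F l -> Ad g X \in so F l.
Proof.
case/andP => ug /eqP gE /eqP XE; apply/eqP; rewrite /Ad.
have ua : antitr g \in unitmx.
  have := @mulmx1_unit _ _ (antitr (invmx g)) (antitr g).
  by rewrite -antitrM mulmxV // antitr1 => /(_ erefl)[].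
have gS : g *m signmx F l = signmx F l *m invmx (antitr g).
  by rewrite {1}gE mulmxKV // signmx_unit.
have Sg : antitr g *m invmx (signmx F l) = invmx (signmx F l) *m invmx g.
  apply: (can_inj (mulKmx signmx_unit)); rewrite mulKVmx ?signmx_unit //.
  apply: (can_inj (mulKmx ug)); rewrite mulmxV // !mulmxA gS.
  by rewrite mulmxKV // mulmxV // signmx_unit.
rewrite !antitrM antitr_inv // !mulmxA -gS -!(mulmxA _ (antitr g)) Sg.
by rewrite {1}XE mulmxN mulNmx !mulmxA.
Qed.

End SignedPermutations.

(* Deciding a test from the context before branching on it keeps the number of
   cases small. *)
Ltac split_if :=
  repeat match goal with |- context [@eq_op _ ?a ?b] =>
    lazymatch constr:((a, b)) with
    | context [if _ then _ else _] => fail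
    | _ => first [ rewrite (_ : (a == b) = false); last lia
                 | rewrite (_ : (a == b) = true); last lia
                 | case: (a =P b) => ? ]; rewrite /=
    end
  end; repeat case: ifP => /= ?.

(** * Cartan matrix entries as conditions on vertices *)

Lemma cartanD_eq0_swap i j : cartanD i j = 0 -> diagram_swap i = j ->
  (i = 1 /\ j = 2 \/ i = 2 /\ j = 1)%N.
(* A vertex fixed by [diagram_swap] would give the diagonal entry 2. *)
Proof. by rewrite /cartanD /diagram_swap; split_if; lia. Qed.

(** Vertices 2, 3, ... form a chain, with 1 attached at 3; the non-adjacent pair 1, 2 is the one
    that [diagram_swap] excludes. *)
Lemma cartanD_eq0 i j : (1 <= i)%N -> (1 <= j)%N ->
  cartanD i j = 0 -> diagram_swap i <> j ->
  ((i = 1 /\ 4 <= j) \/ (j = 1 /\ 4 <= i) \/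
   (2 <= i /\ i.+2 <= j) \/ (2 <= j /\ j.+2 <= i))%N.
Proof. by move=> i1 j1; rewrite /cartanD /diagram_swap; split_if; lia. Qed.

Lemma cartanD_eqN1 i j : cartanD i j = -1 -> (i < j)%N ->
  (i = 1 /\ j = 3)%N \/ (2 <= i /\ j = i.+1)%N.
Proof. by rewrite /cartanD; split_if; lia. Qed.

Lemma cartanD_sym i j : cartanD i j = cartanD j i.
Proof. by rewrite /cartanD; split_if; lia. Qed.

(** * The generators and [SD k] in uniform index notation *)

Section Chevalley.
Variables (F : fieldType) (l : nat).
Hypothesis hl : (2 <= l)%N.
Local Notation bar := (bar l).
Local Notation inrange := (inrange l).

Definition lo k := if k == 1%N then (l - 1)%N else (l + 1 - k)%N.
Definition hi k := if k == 1%N then (l + 1)%N else (l + 2 - k)%N.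

Definition swap k x :=
  if x == lo k then hi k else if x == hi k then lo k
  else if x == bar (lo k) then bar (hi k)
  else if x == bar (hi k) then bar (lo k) else x.

Definition swap_sign k x := (x == bar (lo k)) || (x == bar (hi k)).

Lemma chev_eE k : (1 <= k <= l)%N ->
  chev_e F l k =
  mxunit F l (lo k) (hi k) + mxunit F l (bar (hi k)) (bar (lo k)).
Proof.
move=> hk; rewrite /chev_e /lo /hi /bar; case: eqP => k1; congr (_ + _);
  congr mxunit; lia.
Qed.

Lemma chev_fE k : (1 <= k <= l)%N ->
  chev_f F l k =
  mxunit F l (hi k) (lo k) + mxunit F l (bar (lo k)) (bar (hi k)).
Proof.
move=> hk; rewrite /chev_f /lo /hi /bar; case: eqP => k1; congr (_ + _);
  congr mxunit; lia.
Qed.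

(** [Smx] applies the transposition to the row, [monomial] to the column; a transposition is its own
    inverse. *)
Lemma Smx_monomial a : Smx F l a =
  monomial F l [eta id with a |-> a.+1, a.+1 |-> a] (fun=> false).
Proof.
apply/matrixP => r c; rewrite !mxE /= expr0; congr (_%:R); congr nat_of_bool.
by apply/eqP/eqP; split_if; lia.
Qed.

Lemma Tmx_monomial a : Tmx F l a = monomial F l id (pred1 a).
Proof.
apply/matrixP => r c; rewrite !mxE eqSS val_eqE /=.
by case: (r =P c) => [->|]; rewrite ?mulr0n //; case: eqP.
Qed.

Lemma TmxV a : invmx (Tmx F l a) = Tmx F l a.
Proof.
apply: invmx_right; rewrite Tmx_monomial mul_monomial //.
by apply: monomial1 => // x _; rewrite addbb.
Qed.

Lemma Sbar_monomial a : (1 <= a < 2 * l)%N -> Sbar F l a =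
  monomial F l [eta id with a |-> a.+1, a.+1 |-> a] (pred2 a a.+1).
Proof.
move=> al; rewrite /Sbar TmxV Smx_monomial Tmx_monomial.
rewrite !mul_monomial //=; last first.
  by rewrite /inrange => x; split_if; lia.
by apply: eq_monomial => // x _ /=; split_if; lia.
Qed.

(** For [k > 1] the factors are disjoint transpositions. For [k = 1], conjugation by [Smx l] turns
    (l-1 l)(l+1 l+2) into (l-1 l+1)(l l+2) and moves the minus signs from l+1, l+2 to l, l+2. *)
Lemma SD_monomial k : (1 <= k <= l)%N ->
  SD F l k = monomial F l (swap k) (swap_sign k).
Proof.
move=> hk; rewrite /SD /swap /swap_sign /lo /hi /bar.
case: eqP => k1; rewrite !Sbar_monomial ?Smx_monomial ?mul_monomial //=; try lia;
  try (by rewrite /inrange => x; split_if; lia);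
  apply: eq_monomial => x; rewrite /inrange => xl; split_if; lia.
Qed.

Lemma swapK k x : (1 <= k <= l)%N -> swap k (swap k x) = x.
Proof. by move=> hk; rewrite /swap /lo /hi /bar; split_if; lia. Qed.

Lemma swap_inrange k x : (1 <= k <= l)%N -> inrange x -> inrange (swap k x).
Proof. by move=> hk; rewrite /inrange /swap /lo /hi /bar; split_if; lia. Qed.

(** Both places of an exchanged pair carry the same sign, which makes [SD k] symmetric and of square
    1. *)
Lemma swap_sign_swap k x :
  (1 <= k <= l)%N -> swap_sign k (swap k x) = swap_sign k x.
Proof. by move=> hk; rewrite /swap_sign /swap /lo /hi /bar; split_if; lia. Qed.

Lemma SD_sqr k : (1 <= k <= l)%N -> SD F l k *m SD F l k = 1%:M.
Proof.
move=> hk; rewrite SD_monomial // mul_monomial => [|x]; last exact: swap_inrange.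
apply: monomial1 => x _; first exact: swapK.
by rewrite swap_sign_swap // addbb.
Qed.

Lemma AdSD k X : (1 <= k <= l)%N -> Ad (SD F l k) X = SD F l k *m X *m SD F l k.
Proof. by move=> hk; rewrite /Ad (invmx_right (SD_sqr hk)). Qed.

Lemma tr_SD k : (1 <= k <= l)%N -> (SD F l k)^T = SD F l k.
Proof.
move=> hk; rewrite SD_monomial //; apply/matrixP => r c; rewrite !mxE.
have -> : (c.+1 == swap k r.+1) = (r.+1 == swap k c.+1).
  by apply/eqP/eqP => ->; rewrite swapK.
by case: eqP => [->|//]; rewrite swap_sign_swap.
Qed.

(** * Membership in the orthogonal group and its Lie algebra *)

Lemma antitr_SD k : (1 <= k <= l)%N ->
  antitr (SD F l k) =
  monomial F l (swap k) (fun x => (swap k x != x) (+) swap_sign k x).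
Proof.
move=> hk; rewrite SD_monomial // antitr_monomial => [|x|x]; last 2 first.
- exact: swapK.
- exact: swap_inrange.
apply: eq_monomial => x xl; last rewrite swap_sign_swap //.
  by move: xl; rewrite /inrange /swap /lo /hi /bar; split_if; lia.
(* Reflection by [bar] carries the negated pair to [lo k], [hi k], so the sign changes exactly at
   the moved places. *)
by move: xl; rewrite /inrange /swap_sign /swap /lo /hi /bar; split_if; lia.
Qed.

(** Exchanged places are neighbours in one half for [k > 1]; for [k = 1] they are two apart across
    the middle, where the palindrome repeats a sign. The sign change cancels the one in
    [antitr_SD]. *)
Lemma altsign_swap k x : (1 <= k <= l)%N -> inrange x ->
  altsign l (swap k x) = (swap k x != x) (+) altsign l x.
Proof.
move=> hk; rewrite /inrange /altsign /swap /lo /hi /bar => xl.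
by split_if; lia.
Qed.

Lemma SD_Ogrp k : (1 <= k <= l)%N -> SD F l k \in Ogrp F l.
Proof.
move=> hk; have sr := fun x => @swap_inrange k x hk.
rewrite inE (proj1 (mulmx1_unit (SD_sqr hk))) /= signmxV.
have -> : invmx (antitr (SD F l k)) = antitr (SD F l k).
  by apply: invmx_right; rewrite -antitrM SD_sqr // antitr1.
rewrite antitr_SD // signmxE !mul_monomial // SD_monomial //.
apply/eqP/eq_monomial => // x xl.
rewrite altsign_swap //.
by case: (_ != x); case: altsign; case: swap_sign.
Qed.

Lemma altsign_lo_hi k : (1 <= k <= l)%N -> altsign l (lo k) = ~~ altsign l (hi k).
Proof. by move=> hk; rewrite /altsign /lo /hi; split_if; lia. Qed.

Lemma altsign_bar x : inrange x -> altsign l (bar x) = altsign l x.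
Proof. by rewrite /inrange /altsign /bar; repeat case: ifP => ?; lia. Qed.

Lemma lo_inrange k : (1 <= k <= l)%N -> inrange (lo k).
Proof. by move=> hk; rewrite /inrange /lo; split_if; lia. Qed.

Lemma hi_inrange k : (1 <= k <= l)%N -> inrange (hi k).
Proof. by move=> hk; rewrite /inrange /hi; split_if; lia. Qed.

(** Anti-transposition exchanges the two units, and conjugation by [signmx] negates each, since
    [bar] preserves [altsign]. *)
Lemma so_mxunit a b : inrange a -> inrange b ->
  altsign l a = ~~ altsign l b ->
  mxunit F l a b + mxunit F l (bar b) (bar a) \in so F l.
Proof.
move=> ar br ab; have [ar' br'] := (bar_inrange ar, bar_inrange br).
rewrite inE antitrD !antitr_mxunit // !barK // signmxV mulmxDr mulmxDl signmxE.
rewrite !mul_monomial_mxunit // -!scalemxAl !mul_mxunit_monomial //.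
rewrite !altsign_bar // ab.
by case: (altsign l b);
  rewrite /= ?expr1 ?expr0 ?scaleN1r ?scale1r ?opprD ?opprK addrC.
Qed.

Lemma chev_e_so k : (1 <= k <= l)%N -> chev_e F l k \in so F l.
Proof.
move=> hk; rewrite chev_eE //; apply: so_mxunit; last exact: altsign_lo_hi.
  exact: lo_inrange.
exact: hi_inrange.
Qed.

Lemma chev_f_so k : (1 <= k <= l)%N -> chev_f F l k \in so F l.
Proof.
move=> hk; rewrite chev_fE //; apply: so_mxunit; rewrite ?altsign_lo_hi ?negbK //.
  exact: hi_inrange.
exact: lo_inrange.
Qed.

Lemma Ad_SD_mxunit k a b : (1 <= k <= l)%N -> inrange a -> inrange b ->
  Ad (SD F l k) (mxunit F l a b) =
  (-1) ^+ (swap_sign k a (+) swap_sign k b) *: mxunit F l (swap k a) (swap k b).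
Proof.
move=> hk ar br; rewrite AdSD // SD_monomial // mul_monomial_mxunit //.
rewrite -scalemxAl mul_mxunit_monomial // => [|x]; last exact: swapK.
by rewrite scalerA swap_sign_swap // signr_addb.
Qed.

Lemma tr_chev_e k : (1 <= k <= l)%N -> (chev_e F l k)^T = chev_f F l k.
Proof.
move=> hk; rewrite chev_eE // chev_fE //.
by apply/matrixP => r c; rewrite !mxE !(andbC (c.+1 == _)).
Qed.

Lemma tr_Ad_SD k X : (1 <= k <= l)%N -> (Ad (SD F l k) X)^T = Ad (SD F l k) X^T.
Proof. by move=> hk; rewrite !AdSD // !trmx_mul tr_SD // mulmxA. Qed.

Lemma tr_ad (X Y : 'M[F]_(2 * l)) : (ad X Y)^T = - ad X^T Y^T.
Proof. by rewrite /ad raddfB /= !trmx_mul opprB. Qed.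

(** * The formulas for the [chev_e j], case by case *)

Lemma Ad_SD_chev_e i j : (1 <= i <= l)%N -> (1 <= j <= l)%N ->
  Ad (SD F l i) (chev_e F l j) =
  (-1) ^+ (swap_sign i (lo j) (+) swap_sign i (hi j)) *:
    mxunit F l (swap i (lo j)) (swap i (hi j)) +
  (-1) ^+ (swap_sign i (bar (hi j)) (+) swap_sign i (bar (lo j))) *:
    mxunit F l (swap i (bar (hi j))) (swap i (bar (lo j))).
Proof.
move=> il jl; have [lr hr] := (lo_inrange jl, hi_inrange jl).
rewrite chev_eE // {1}/Ad mulmxDr mulmxDl -!/(Ad _ _).
by rewrite !Ad_SD_mxunit //; apply: bar_inrange.
Qed.

Lemma ad_chev_e i j : (1 <= i <= l)%N -> (1 <= j <= l)%N ->
  ad (chev_e F l i) (chev_e F l j) =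
  mxunit F l (lo i) (hi j) *+ (hi i == lo j) +
  mxunit F l (lo i) (bar (lo j)) *+ (hi i == bar (hi j)) +
  (mxunit F l (bar (hi i)) (hi j) *+ (bar (lo i) == lo j) +
   mxunit F l (bar (hi i)) (bar (lo j)) *+ (bar (lo i) == bar (hi j))) -
  (mxunit F l (lo j) (hi i) *+ (hi j == lo i) +
  mxunit F l (lo j) (bar (lo i)) *+ (hi j == bar (hi i)) +
  (mxunit F l (bar (hi j)) (hi i) *+ (bar (lo j) == lo i) +
   mxunit F l (bar (hi j)) (bar (lo i)) *+ (bar (lo j) == bar (hi i)))).
Proof.
move=> il jl; have [lir hir] := (lo_inrange il, hi_inrange il).
have [ljr hjr] := (lo_inrange jl, hi_inrange jl).
have br := bar_inrange.
by rewrite /ad !chev_eE // !mulmxDl !mulmxDr !mul_mxunit //; apply: br.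
Qed.

Lemma Ad_SD_chev_e_diag i : (1 <= i <= l)%N ->
  Ad (SD F l i) (chev_e F l i) = chev_f F l i.
Proof.
move=> il; rewrite Ad_SD_chev_e // chev_fE //.
rewrite /swap_sign /swap /lo /hi /bar.
split_if; rewrite !expr0 !scale1r; congr (_ + _); congr mxunit; lia.
Qed.

(** [SD i] exchanges the two units of [chev_e j], and exactly one index of each is negated. *)
Lemma Ad_SD_chev_e_swap i j : (1 <= i <= l)%N -> (1 <= j <= l)%N ->
  cartanD i j = 0 -> diagram_swap i = j ->
  Ad (SD F l i) (chev_e F l j) = - chev_e F l j.
Proof.
move=> il jl a0 ij; rewrite Ad_SD_chev_e // chev_eE //.
rewrite /swap_sign /swap /lo /hi /bar.
by case: (cartanD_eq0_swap a0 ij) => -[i_ j_]; split_if;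
  rewrite !expr1 !scaleN1r opprD addrC; congr (- _ - _); congr mxunit; lia.
Qed.

(** The places moved by [SD i] are disjoint from the indices of [chev_e j]. *)
Lemma Ad_SD_chev_e_fix i j : (1 <= i <= l)%N -> (1 <= j <= l)%N ->
  cartanD i j = 0 -> diagram_swap i <> j ->
  Ad (SD F l i) (chev_e F l j) = chev_e F l j.
Proof.
move=> il jl a0 ij; rewrite Ad_SD_chev_e // chev_eE //.
have [[i1 _] [j1 _]] := (andP il, andP jl).
rewrite /swap_sign /swap /lo /hi /bar.
case: (cartanD_eq0 i1 j1 a0 ij) => [[i_ j_]|[[i_ j_]|[[i_ j_]|[i_ j_]]]];
  by split_if; rewrite !expr0 !scale1r.
Qed.

(** Here [hi j = lo i]: two of the eight products in the bracket survive, with opposite signs, and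
    [SD i] negates only the barred unit. *)
Lemma Ad_SD_chev_e_lt i j : (1 <= i <= l)%N -> (1 <= j <= l)%N ->
  cartanD i j = -1 -> (i < j)%N ->
  Ad (SD F l i) (chev_e F l j) = - ad (chev_e F l i) (chev_e F l j).
Proof.
move=> il jl aN1 ij; rewrite Ad_SD_chev_e // ad_chev_e //.
rewrite /swap_sign /swap /lo /hi /bar.
by case: (cartanD_eqN1 aN1 ij) => -[i_ j_]; split_if;
  rewrite ?expr0 ?expr1 ?scale1r ?scaleN1r ?mulr0n ?mulr1n ?addr0 ?add0r
    ?sub0r ?opprB ?oppr0 ?addr0.
Qed.

(** Now [hi i = lo j], so the surviving unbarred product comes from the positive half of the
    bracket. *)
Lemma Ad_SD_chev_e_gt i j : (1 <= i <= l)%N -> (1 <= j <= l)%N ->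
  cartanD i j = -1 -> (j < i)%N ->
  Ad (SD F l i) (chev_e F l j) = ad (chev_e F l i) (chev_e F l j).
Proof.
move=> il jl aN1 ij; rewrite Ad_SD_chev_e // ad_chev_e //.
rewrite cartanD_sym in aN1.
rewrite /swap_sign /swap /lo /hi /bar.
by case: (cartanD_eqN1 aN1 ij) => -[i_ j_]; split_if;
  rewrite ?expr0 ?expr1 ?scale1r ?scaleN1r ?mulr0n ?mulr1n ?addr0 ?add0r
    ?sub0r ?opprB ?oppr0 ?addr0.
Qed.

End Chevalley.

(** * Assembly over the complex numbers, with the [f] formulas by transposition *)

Theorem proposition9p5 (R : realType) (l i j : nat)
    (hl : (2 <= l)%N) (hi : (1 <= i <= l)%N) (hj : (1 <= j <= l)%N) :
  let e := chev_e (complex R) l in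
  let f := chev_f (complex R) l in
  let S := SD (complex R) l i in
  [/\ S \in Ogrp (complex R) l,
      e j \in so (complex R) l /\ f j \in so (complex R) l,
      forall X, X \in so (complex R) l -> Ad S X \in so (complex R) l,
      [/\ i = j -> Ad S (e j) = f j,
          cartanD i j = 0 -> diagram_swap i = j -> Ad S (e j) = - e j,
          cartanD i j = 0 -> diagram_swap i <> j -> Ad S (e j) = e j,
          cartanD i j = -1 -> (i < j)%N -> Ad S (e j) = - ad (e i) (e j)
        & cartanD i j = -1 -> (i > j)%N -> Ad S (e j) = ad (e i) (e j)]
    & [/\ i = j -> Ad S (f j) = e j,
          cartanD i j = 0 -> diagram_swap i = j -> Ad S (f j) = - f j,
          cartanD i j = 0 -> diagram_swap i <> j -> Ad S (f j) = f j,
          cartanD i j = -1 -> (i < j)%N -> Ad S (f j) = ad (f i) (f j)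
        & cartanD i j = -1 -> (i > j)%N -> Ad S (f j) = - ad (f i) (f j)]].
Proof.
move=> e f S; rewrite {}/e {}/f {}/S.
have fE Y : Ad (SD (complex R) l i) (chev_e _ l j) = Y ->
  Ad (SD (complex R) l i) (chev_f _ l j) = Y^T.
  by move=> <-; rewrite tr_Ad_SD // tr_chev_e.
have tr_ad_e : (ad (chev_e (complex R) l i) (chev_e _ l j))^T =
    - ad (chev_f _ l i) (chev_f _ l j) by rewrite tr_ad !tr_chev_e.
split.
- exact: SD_Ogrp.
- by rewrite chev_e_so // chev_f_so.
- by move=> X; apply/Ad_so/SD_Ogrp.
- split.
  + by move=> <-; exact: Ad_SD_chev_e_diag.
  + exact: Ad_SD_chev_e_swap.
  + exact: Ad_SD_chev_e_fix.
  + exact: Ad_SD_chev_e_lt.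
  + exact: Ad_SD_chev_e_gt.
- split.
  + move=> ij; rewrite -[chev_e _ l j]trmxK tr_chev_e //; apply: fE.
    by rewrite -ij; exact: Ad_SD_chev_e_diag.
  + move=> a0 ij; rewrite -[in RHS]tr_chev_e // -raddfN /=; apply: fE.
    exact: Ad_SD_chev_e_swap.
  + move=> a0 ij; rewrite -[RHS]tr_chev_e //; apply: fE.
    exact: Ad_SD_chev_e_fix.
  + move=> a1 ij; rewrite -[RHS]opprK -tr_ad_e -raddfN /=; apply: fE.
    exact: Ad_SD_chev_e_lt.
  + move=> a1 ij; rewrite -tr_ad_e; apply: fE.
    exact: Ad_SD_chev_e_gt.
Qed.
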